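(* Let $w\in F_2=F(x_1,x_2)$ be an Ivanov word and let $G_w=A\ast_{\langle w\rangle}B$ be the double of $F_2$ along $w$. Then after precomposition with a Dehn twist, every homomorphism from $G_w$ to a non-abelian free group factors through either the canonical retraction $\pi:G_w\to A$ or the projection $\eta:G_w\to\mathbb{Z}^2\ast\mathbb{Z}^2$. That is, for every non-abelian free group $F$ and every homomorphism $\varphi:G_w\to F$ there is a Dehn twist $\alpha$ of $G_w$ along $\langle w\rangle$ such that $\varphi\circ\alpha$ factors through $\pi$ or through $\eta$.
   Context: Double: for $1\neq w\in F_2=F(x_1,x_2)$, the double of $F_2$ along $w$ is $G_w=A\ast_C B$ with $A=F(a_1,a_2)$, $B=F(b_1,b_2)$ free of rank 2, $C=\langle c\rangle\cong\mathbb{Z}$, and embeddings $c\mapsto w_A:=w(a_1,a_2)$, $c\mapsto w_B:=w(b_1,b_2)$. Thus $G_w=\langle a_1,a_2,b_1,b_2\mid w(a_1,a_2)=w(b_1,b_2)\rangle$. C-test word: a non-trivial word $w\in F_n$ is a C-test word in $n$ letters if for any two $n$-tuples $(A_1,\dots,A_n)$, $(B_1,\dots,B_n)$ of elements of a non-abelian free group $F$, the equality $w(A_1,\dots,A_n)=w(B_1,\dots,B_n)\neq1$ implies that there is $S\in F$ with $SA_iS^{-1}=B_i$ for all $i$. Ivanov word (in $F_2$): a C-test word $w\in F_2$ such that (i) $w$ is not a proper power; (ii) for elements $A_1,A_2$ of a free group, $w(A_1,A_2)=1$ if and only if $\langle A_1,A_2\rangle$ is cyclic; (iii) if $\varphi,\Psi$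 are endomorphisms of $F_2$, $\Psi$ has non-cyclic image and $\varphi(w)=\Psi(w)$, then $\varphi=c_S\circ\Psi$ for some $S\in\langle\Psi(w)\rangle$, where $c_S$ denotes conjugation by $S$. It is known (Ivanov) that every C-test word in $F_n$ lies in the commutator subgroup of $F_n$. Maps: a Dehn twist of $G_w$ along $\langle w\rangle$ is an automorphism $\alpha$ of $G_w$ with $\alpha|_A=\mathrm{id}$ and $\alpha|_B$ equal to conjugation by $w_B^k$ for some $k\in\mathbb{Z}$. The canonical retraction $\pi:G_w\to A$ is the identity on $A$ and sends $b_i\mapsto a_i$. The projection $\eta:G_w\to A/[A,A]\ast B/[B,B]\cong\mathbb{Z}^2\ast\mathbb{Z}^2$ is induced by the abelianization maps of $A$ and $B$ (well defined because $w\in[F_2,F_2]$). *)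

(* Defs.v *)
From HB Require Import structures.
From mathcomp Require Import all_boot.
From mathcomp Require Import ssralg ssrint.
From mathcomp Require Import generic_quotient boolp.

Set Implicit Arguments.
Unset Strict Implicit.
Unset Printing Implicit Defensive.

Local Open Scope group_scope.

Reserved Notation "{ 'hom' G -> H }" (G at level 98, H at level 99,
  format "{ 'hom'  G  ->  H }").
Notation "{ 'hom' G -> H }" :=
  (UMagmaMorphism.type G%type H%type) : type_scope.

(* The free group on X is the set of reduced words, i.e. of sequences of      *)
(* letters (x, e), where (x, false) stands for x and (x, true) for x^-1, with *)
(* no two consecutive mutually inverse letters.                               *)
Section FreeGroup.
Variable X : choiceType.
Local Notation letter := (X * bool)%type.

Definition letter_inv (s : letter) : letter := (s.1, ~~ s.2).

Definition reduced (u : seq letter) : bool :=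
  sorted (fun s t => t != letter_inv s) u.

Record free_group := FreeGroup { fword : seq letter; _ : reduced fword }.

HB.instance Definition _ := [isSub for fword].
HB.instance Definition _ := [Choice of free_group by <:].

Definition letter_mul (s : letter) (u : seq letter) : seq letter :=
  if u is t :: v then if t == letter_inv s then v else s :: u else [:: s].

Definition word_mul (u v : seq letter) : seq letter := foldr letter_mul v u.

Definition word_inv (u : seq letter) : seq letter := rev (map letter_inv u).

Lemma letter_invK : involutive letter_inv.
Proof. by case=> x b; rewrite /letter_inv /= negbK. Qed.

Lemma letter_mul_reduced s u : reduced u -> reduced (letter_mul s u).
Proof.
case: u => [|t v] //= tv; case: ifPn => [_|ts]; last by rewrite /= ts.
by rewrite /reduced; apply: path_sorted tv.
Qed.

Lemma word_mul_reduced u v : reduced v -> reduced (word_mul u v).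
Proof. by move=> rv; elim: u => //= s u; apply: letter_mul_reduced. Qed.

Lemma letter_mulK s u :
  reduced u -> letter_mul s (letter_mul (letter_inv s) u) = u.
Proof.
case: u => [|t v] /=; first by rewrite eqxx.
rewrite letter_invK; case: eqP => [->|_ _] /=; last by rewrite eqxx.
by case: v => [|r v] //= /andP[/negPf ->].
Qed.

Lemma word_mul_letter s u w : reduced w ->
  word_mul (letter_mul s u) w = letter_mul s (word_mul u w).
Proof.
case: u => [|t v] //= rw; case: eqP => [->|_] //.
by rewrite letter_mulK // word_mul_reduced.
Qed.

Lemma word_mulA u v w : reduced w ->
  word_mul u (word_mul v w) = word_mul (word_mul u v) w.
Proof. by move=> rw; elim: u => //= s u ->; rewrite word_mul_letter. Qed.

Lemma word_mulw1 u : reduced u -> word_mul u [::] = u.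
Proof.
elim: u => //= s u IHu rsu; rewrite IHu; last exact: path_sorted rsu.
by case: u rsu {IHu} => //= t u /andP[/negPf ->].
Qed.

Lemma word_mulVw u : word_mul (word_inv u) u = [::].
Proof.
rewrite /word_inv /word_mul; elim: u => //= s u IHu.
by rewrite rev_cons foldr_rcons /= letter_invK eqxx.
Qed.

Lemma word_invK : involutive word_inv.
Proof.
move=> u; rewrite /word_inv map_rev revK -map_comp -[RHS]map_id.
by apply: eq_map; apply: letter_invK.
Qed.

Lemma word_inv_reduced u : reduced u -> reduced (word_inv u).
Proof.
rewrite /reduced /word_inv rev_sorted sorted_map; apply: sub_sorted => s t.
by apply: contraNN => /eqP ->; rewrite letter_invK.
Qed.

Fact fword_reduced (u : free_group) : reduced (fword u).
Proof. by case: u. Qed.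

Definition fg_one : free_group := @FreeGroup [::] isT.
Definition fg_mul (u v : free_group) : free_group :=
  FreeGroup (word_mul_reduced (fword u) (fword_reduced v)).
Definition fg_inv (u : free_group) : free_group :=
  FreeGroup (word_inv_reduced (fword_reduced u)).

Fact fg_mulA : associative fg_mul.
Proof. by move=> u v w; apply/val_inj/word_mulA/fword_reduced. Qed.
Fact fg_mul1g : left_id fg_one fg_mul.
Proof. by move=> u; apply/val_inj. Qed.
Fact fg_mulg1 : right_id fg_one fg_mul.
Proof. by move=> u; apply/val_inj/word_mulw1/fword_reduced. Qed.
Fact fg_mulVg : left_inverse fg_one fg_inv fg_mul.
Proof. by move=> u; apply/val_inj/word_mulVw. Qed.
Fact fg_mulgV : right_inverse fg_one fg_inv fg_mul.
Proof.
by move=> u; apply/val_inj; rewrite /= -{1}[fword u]word_invK word_mulVw.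
Qed.

HB.instance Definition _ := isGroup.Build free_group
  fg_mulA fg_mul1g fg_mulg1 fg_mulVg fg_mulgV.

Definition fgen (x : X) : free_group := @FreeGroup [:: (x, false)] isT.

Section Eval.
Variables (H : groupType) (f : X -> H).

Definition letter_eval (s : letter) : H := if s.2 then (f s.1)^-1 else f s.1.

(* [feval f u] is the value u(f) of the word u when each generator x is       *)
(* replaced by f x, so [feval f] is the homomorphism extending f.             *)
Definition feval (u : free_group) : H := \prod_(s <- fword u) letter_eval s.

Fact feval1 : feval 1 = 1.
Proof. by rewrite /feval big_nil. Qed.

Fact fevalM : {morph feval : u v / u * v}.
Proof.
move=> u v; rewrite /feval /= /fg_mul /=.
elim: (fword u) => [|s w IHw] /=; first by rewrite big_nil mul1g.
rewrite big_cons -mulgA -IHw; case: (word_mul w _) => [|t z] /=.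
  by rewrite big_seq1 big_nil mulg1.
case: eqP => [->|_]; last by rewrite big_cons.
rewrite big_cons /letter_eval /=; case: (s.2) => /=.
  by rewrite mulKg.
by rewrite mulVKg.
Qed.

HB.instance Definition _ :=
  isMultiplicative.Build free_group H feval fevalM.
HB.instance Definition _ :=
  Multiplicative_isUMagmaMorphism.Build free_group H feval feval1.

Lemma feval_gen x : feval (fgen x) = f x.
Proof. by rewrite /feval big_seq1. Qed.

End Eval.

Lemma feval_unique (H : groupType) (f : X -> H) (g : {hom free_group -> H}) :
  (forall x, g (fgen x) = f x) -> g =1 feval f.
Proof.
move=> gf [u ru]; rewrite /feval /=; elim: u ru => [|s u IHu] rsu.
  by rewrite big_nil -(@gmulf1 _ _ g); congr (g _); apply: val_inj.
have ru : reduced u by apply: path_sorted rsu.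
rewrite big_cons -(IHu ru).
have -> : FreeGroup rsu =
    (if s.2 then (fgen s.1)^-1 else fgen s.1) * FreeGroup ru.
  apply: val_inj; case: s rsu => x [] /=.
    by case: u {IHu ru} => [|t u] //= /andP[/negPf ->].
  by case: u {IHu ru} => [|t u] //= /andP[/negPf ->].
rewrite gmulfM /letter_eval; case: (s.2); last by rewrite gf.
by rewrite gmulfV gf.
Qed.

Lemma free_hom_ext (H : groupType) (g h : {hom free_group -> H}) :
  (forall x, g (fgen x) = h (fgen x)) -> g =1 h.
Proof.
move=> gh u; rewrite (@feval_unique _ (h \o fgen) g) //.
exact/esym/feval_unique.
Qed.

End FreeGroup.

Notation "''F(' n )" := (free_group 'I_n)
  (at level 0, format "''F(' n )") : type_scope.

Definition is_free (F : groupType) : Prop :=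
  exists (X : choiceType) (f : {hom free_group X -> F}), bijective f.

Definition nonabelian (G : groupType) : Prop := exists x y : G, x * y <> y * x.

Section Subgroups.
Variable G : groupType.

Definition zexpg (x : G) (k : int) : G :=
  match k with Posz n => x ^+ n | Negz n => x ^- n.+1 end.

Definition in_cycle (x y : G) : Prop := exists k : int, y = zexpg x k.

Definition is_cyclic (S : G -> Prop) : Prop :=
  exists z : G, forall y, S y <-> in_cycle z y.

Inductive generated (S : G -> Prop) : G -> Prop :=
| generated_in x : S x -> generated S x
| generated1 : generated S 1
| generatedM x y : generated S x -> generated S y -> generated S (x * y)
| generatedV x : generated S x -> generated S x^-1.

End Subgroups.

Definition hom_range (G H : Type) (f : G -> H) : H -> Prop :=
  fun y => exists x, y = f x.

Section Quotient.
Variables (G : groupType) (R : G -> Prop).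

Inductive normal_closure : G -> Prop :=
| ncl_in x : R x -> normal_closure x
| ncl1 : normal_closure 1
| nclM x y : normal_closure x -> normal_closure y -> normal_closure (x * y)
| nclV x : normal_closure x -> normal_closure x^-1
| nclJ x y : normal_closure x -> normal_closure (x ^ y).

Definition ncl_rel : rel G := fun x y => `[< normal_closure (x / y) >].

Fact ncl_rel_refl : reflexive ncl_rel.
Proof. by move=> x; apply/asboolP; rewrite divgg; apply: ncl1. Qed.

Fact ncl_rel_sym : symmetric ncl_rel.
Proof.
by move=> x y; apply/asboolP/asboolP => /nclV; rewrite invgF.
Qed.

Fact ncl_rel_trans : transitive ncl_rel.
Proof.
move=> y x z /asboolP xy /asboolP yz; apply/asboolP.
by rewrite -[x](mulgVK y) -mulgA; apply: nclM.
Qed.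

Definition ncl_equiv := EquivRel ncl_rel ncl_rel_refl ncl_rel_sym ncl_rel_trans.
Canonical ncl_equiv.

Definition quot_group := {eq_quot ncl_equiv}%qT.
HB.instance Definition _ := Choice.on quot_group.

Definition quot_pi (x : G) : quot_group := (\pi_({eq_quot ncl_equiv})%qT x)%qT.
Definition quot_repr (q : quot_group) : G := repr (q : {eq_quot ncl_equiv}%qT).

Lemma quot_reprK : cancel quot_repr quot_pi.
Proof. by move=> q; apply: reprK. Qed.

Lemma quot_piP x y : quot_pi x = quot_pi y <-> normal_closure (x / y).
Proof.
split; first by move/eqmodP/asboolP.
by move=> xy; apply/eqmodP/asboolP.
Qed.

Definition quot_mul (p q : quot_group) : quot_group :=
  quot_pi (quot_repr p * quot_repr q).
Definition quot_inv (p : quot_group) : quot_group := quot_pi (quot_repr p)^-1.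
Definition quot_one : quot_group := quot_pi 1.

Lemma quot_piM x y : quot_pi (x * y) = quot_mul (quot_pi x) (quot_pi y).
Proof.
apply/quot_piP.
set x' := quot_repr _; set y' := quot_repr _.
have xx' : normal_closure (x / x') by apply/quot_piP; rewrite quot_reprK.
have yy' : normal_closure (y / y') by apply/quot_piP; rewrite quot_reprK.
have -> : x * y / (x' * y') = (y / y') ^ x^-1 * (x / x').
  by rewrite conjgE invgK invgM !mulgA mulgVK.
by apply: nclM => //; apply: nclJ.
Qed.

Lemma quot_piV x : quot_pi x^-1 = quot_inv (quot_pi x).
Proof.
apply/quot_piP; set x' := quot_repr _.
have xx' : normal_closure (x / x') by apply/quot_piP; rewrite quot_reprK.
have -> : x^-1 / x'^-1 = ((x / x')^-1) ^ x.
  by rewrite conjgE invgF invgK !mulgA mulgVK.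
by apply: nclJ; apply: nclV.
Qed.

Fact quot_mulA : associative quot_mul.
Proof.
move=> p q r; rewrite -[p]quot_reprK -[q]quot_reprK -[r]quot_reprK.
by rewrite -!quot_piM mulgA.
Qed.
Fact quot_mul1g : left_id quot_one quot_mul.
Proof. by move=> p; rewrite -[p]quot_reprK -quot_piM mul1g. Qed.
Fact quot_mulg1 : right_id quot_one quot_mul.
Proof. by move=> p; rewrite -[p]quot_reprK -quot_piM mulg1. Qed.
Fact quot_mulVg : left_inverse quot_one quot_inv quot_mul.
Proof. by move=> p; rewrite -[p]quot_reprK -quot_piV -quot_piM mulVg. Qed.
Fact quot_mulgV : right_inverse quot_one quot_inv quot_mul.
Proof. by move=> p; rewrite -[p]quot_reprK -quot_piV -quot_piM mulgV. Qed.

HB.instance Definition _ := isGroup.Build quot_group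
  quot_mulA quot_mul1g quot_mulg1 quot_mulVg quot_mulgV.

Fact quot_pi_mul : {morph quot_pi : x y / x * y}.
Proof. exact: quot_piM. Qed.

HB.instance Definition _ :=
  isMultiplicative.Build G quot_group quot_pi quot_pi_mul.
HB.instance Definition _ :=
  Multiplicative_isUMagmaMorphism.Build G quot_group quot_pi erefl.

Section Lift.
Variables (H : groupType) (f : {hom G -> H}) (fR : forall x, R x -> f x = 1).

Lemma hom_normal_closure x : normal_closure x -> f x = 1.
Proof.
elim=> {x} [x /fR||x y _ fx _ fy|x _ fx|x y _ fx] //.
- exact: gmulf1.
- by rewrite gmulfM fx fy mulg1.
- by rewrite gmulfV fx invg1.
- by rewrite gmulfJ fx conj1g.
Qed.

Definition quot_lift of (forall x, R x -> f x = 1) :=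
  fun q : quot_group => f (quot_repr q).

Lemma quot_lift_pi x : quot_lift fR (quot_pi x) = f x.
Proof.
apply/divg1_eq; rewrite -gmulfF; apply: hom_normal_closure.
by apply/quot_piP; rewrite quot_reprK.
Qed.

Fact quot_liftM : {morph quot_lift fR : p q / p * q}.
Proof.
move=> p q; rewrite -[p]quot_reprK -[q]quot_reprK -gmulfM.
by rewrite !quot_lift_pi gmulfM.
Qed.
Fact quot_lift1 : quot_lift fR 1 = 1.
Proof. by rewrite quot_lift_pi gmulf1. Qed.

HB.instance Definition _ :=
  isMultiplicative.Build quot_group H (quot_lift fR) quot_liftM.
HB.instance Definition _ :=
  Multiplicative_isUMagmaMorphism.Build quot_group H (quot_lift fR)
    quot_lift1.

End Lift.

Lemma quot_hom_ext (H : groupType) (g h : {hom quot_group -> H}) :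
  (forall x, g (quot_pi x) = h (quot_pi x)) -> g =1 h.
Proof. by move=> gh q; rewrite -[q]quot_reprK. Qed.

End Quotient.

Definition is_commutator (G : groupType) : G -> Prop :=
  fun z => exists x y : G, z = [~ x, y].

Arguments quot_pi : simpl never.
Arguments quot_lift : simpl never.

Definition abelianization (G : groupType) : groupType :=
  quot_group (@is_commutator G).

Definition ab_pi (G : groupType) : {hom G -> abelianization G} :=
  @quot_pi G (@is_commutator G).

Lemma abelianizationC (G : groupType) (p q : abelianization G) : p * q = q * p.
Proof.
rewrite -[p]quot_reprK -[q]quot_reprK -!(@gmulfM _ _ (@ab_pi G)).
apply/quot_piP; apply: ncl_in.
exists (quot_repr p)^-1, (quot_repr q)^-1.
by rewrite commgEl conjgE !invgK invgM !mulgA.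
Qed.

Section FreeProduct.
Variables A B : groupType.

(* A * B is presented by the disjoint union of A and B, with the two          *)
(* multiplication tables as relators.                                         *)
Inductive free_prod_rel : free_group (A + B)%type -> Prop :=
| free_prod_rel_l (x y : A) :
    free_prod_rel (fgen (inl x) * fgen (inl y) / fgen (inl (x * y)))
| free_prod_rel_r (x y : B) :
    free_prod_rel (fgen (inr x) * fgen (inr y) / fgen (inr (x * y))).

Definition free_prod : groupType := quot_group free_prod_rel.

Definition fp_inl (x : A) : free_prod := quot_pi free_prod_rel (fgen (inl x)).
Definition fp_inr (x : B) : free_prod := quot_pi free_prod_rel (fgen (inr x)).

Fact fp_inlM : {morph fp_inl : x y / x * y}.
Proof.
move=> x y; rewrite /fp_inl -gmulfM; apply/esym/quot_piP.
by apply: ncl_in; apply: free_prod_rel_l.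
Qed.
Fact fp_inrM : {morph fp_inr : x y / x * y}.
Proof.
move=> x y; rewrite /fp_inr -gmulfM; apply/esym/quot_piP.
by apply: ncl_in; apply: free_prod_rel_r.
Qed.
Fact fp_inl1 : fp_inl 1 = 1.
Proof. by apply: (@mulgI _ (fp_inl 1)); rewrite -fp_inlM !mulg1. Qed.
Fact fp_inr1 : fp_inr 1 = 1.
Proof. by apply: (@mulgI _ (fp_inr 1)); rewrite -fp_inrM !mulg1. Qed.

HB.instance Definition _ :=
  isMultiplicative.Build A free_prod fp_inl fp_inlM.
HB.instance Definition _ :=
  Multiplicative_isUMagmaMorphism.Build A free_prod fp_inl fp_inl1.
HB.instance Definition _ :=
  isMultiplicative.Build B free_prod fp_inr fp_inrM.
HB.instance Definition _ :=
  Multiplicative_isUMagmaMorphism.Build B free_prod fp_inr fp_inr1.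

Section Lift.
Variables (H : groupType) (f : {hom A -> H}) (g : {hom B -> H}).

Definition fp_gen (z : A + B) : H := match z with inl x => f x | inr y => g y end.

Fact fp_gen_rel z : free_prod_rel z -> feval fp_gen z = 1.
Proof.
by case=> x y; rewrite gmulfF gmulfM /= !feval_gen /= gmulfM divgg.
Qed.

Definition fp_lift : {hom free_prod -> H} := quot_lift fp_gen_rel.

Lemma fp_lift_inl x : fp_lift (fp_inl x) = f x.
Proof. by rewrite /fp_lift /fp_inl /= quot_lift_pi /= feval_gen. Qed.
Lemma fp_lift_inr y : fp_lift (fp_inr y) = g y.
Proof. by rewrite /fp_lift /fp_inr /= quot_lift_pi /= feval_gen. Qed.

End Lift.

Lemma fp_hom_ext (H : groupType) (g h : {hom free_prod -> H}) :
  (forall x, g (fp_inl x) = h (fp_inl x)) ->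
  (forall y, g (fp_inr y) = h (fp_inr y)) -> g =1 h.
Proof.
move=> ghA ghB; apply: quot_hom_ext => x.
pose g' : {hom free_group (A + B)%type -> H} := g \o quot_pi free_prod_rel.
pose h' : {hom free_group (A + B)%type -> H} := h \o quot_pi free_prod_rel.
by apply: (@free_hom_ext _ _ g' h') => -[x'|y']; [apply: ghA|apply: ghB].
Qed.

End FreeProduct.

Section Amalgam.
Variables (C A B : groupType) (i : {hom C -> A}) (j : {hom C -> B}).

Definition amalgam_rel : free_prod A B -> Prop :=
  fun z => exists c : C, z = fp_inl B (i c) / fp_inr A (j c).

(* The amalgamated free product A *_C B along i : C -> A and j : C -> B.      *)
Definition amalgam : groupType := quot_group amalgam_rel.

Definition am_inl : {hom A -> amalgam} := quot_pi amalgam_rel \o fp_inl B.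
Definition am_inr : {hom B -> amalgam} := quot_pi amalgam_rel \o @fp_inr A B.

Lemma am_glue c : am_inl (i c) = am_inr (j c).
Proof. by apply/quot_piP; apply: ncl_in; exists c. Qed.

Section Lift.
Variables (H : groupType) (f : {hom A -> H}) (g : {hom B -> H}).
Hypothesis fg : forall c, f (i c) = g (j c).

Fact am_lift_rel z : amalgam_rel z -> fp_lift f g z = 1.
Proof.
by case=> c ->; rewrite gmulfF fp_lift_inl fp_lift_inr fg divgg.
Qed.

Definition am_lift : {hom amalgam -> H} := quot_lift am_lift_rel.

Lemma am_lift_inl x : am_lift (am_inl x) = f x.
Proof. by rewrite /am_lift /am_inl /= quot_lift_pi fp_lift_inl. Qed.
Lemma am_lift_inr y : am_lift (am_inr y) = g y.
Proof. by rewrite /am_lift /am_inr /= quot_lift_pi fp_lift_inr. Qed.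

End Lift.

Lemma am_hom_ext (H : groupType) (g h : {hom amalgam -> H}) :
  (forall x, g (am_inl x) = h (am_inl x)) ->
  (forall y, g (am_inr y) = h (am_inr y)) -> g =1 h.
Proof.
move=> ghA ghB; apply: quot_hom_ext => x.
pose g' : {hom free_prod A B -> H} := g \o quot_pi amalgam_rel.
pose h' : {hom free_prod A B -> H} := h \o quot_pi amalgam_rel.
exact: (@fp_hom_ext _ _ _ g' h').
Qed.

End Amalgam.

Definition C_test_word (n : nat) (w : 'F(n)) : Prop :=
  w <> 1 /\
  forall F : groupType, is_free F -> nonabelian F ->
  forall A B : 'I_n -> F, feval A w = feval B w -> feval A w <> 1 ->
  exists S : F, forall i, S * A i * S^-1 = B i.

Definition proper_power (G : groupType) (x : G) : Prop :=
  exists (y : G) (n : nat), 1 < n /\ x = y ^+ n.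

Record Ivanov_word (w : 'F(2)) : Prop := {
  Ivanov_C_test : C_test_word w;
  Ivanov_not_power : ~ proper_power w;
  Ivanov_cyclic : forall F : groupType, is_free F -> forall A : 'I_2 -> F,
    feval A w = 1 <-> is_cyclic (generated (hom_range A));
  Ivanov_endo : forall phi Psi : {hom 'F(2) -> 'F(2)},
    ~ is_cyclic (hom_range Psi) -> phi w = Psi w ->
    exists S, in_cycle (Psi w) S /\ forall x, phi x = S * Psi x * S^-1
}.

Lemma is_free_free_group (X : choiceType) : is_free (free_group X).
Proof. by exists X, idfun; exists id. Qed.

Lemma zexpgM (G : groupType) (x : G) k l :
  exists m, zexpg x k * zexpg x l = zexpg x m.
Proof.
suff E a b : exists m, x ^+ a / x ^+ b = zexpg x m.
  have Ek c : exists a b, zexpg x c = x ^+ a / x ^+ b.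
    case: c => n; first by exists n, 0%N; rewrite invg1 mulg1.
    by exists 0%N, n.+1; rewrite mul1g.
  have [a [b ->]] := Ek k; have [c [d ->]] := Ek l.
  have [m Em] := E (a + c)%N (d + b)%N; exists m.
  rewrite -Em !expgnDr invgM !mulgA; congr (_ / _).
  have cm : commute (x ^+ c) (x ^+ b)^-1 by apply/commuteV/commuteX2.
  by rewrite -!mulgA cm.
case: (leqP b a) => [le_ba|lt_ab].
  by exists (Posz (a - b)); rewrite /= expgnFr.
exists (Negz (b - a).-1); rewrite /= prednK ?subn_gt0 //.
by rewrite expgnFr ?(ltnW lt_ab) // invgF.
Qed.

Lemma zexpgV (G : groupType) (x : G) k : exists m, (zexpg x k)^-1 = zexpg x m.
Proof.
case: k => [[|n]|n]; first by exists (Posz 0); rewrite /= invg1.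
  by exists (Negz n).
by exists (Posz n.+1); rewrite /= invgK.
Qed.

Lemma generated_cyclic (G : groupType) (S : G -> Prop) z :
  S z -> (forall y, S y -> in_cycle z y) -> is_cyclic (generated S).
Proof.
move=> Sz Sc; exists z => y; split=> [|[k ->]].
  elim=> {y} [y /Sc //||x y _ [k ->] _ [l ->]|x _ [k ->]].
  - by exists (Posz 0).
  - exact: zexpgM.
  - exact: zexpgV.
have gX n : generated S (z ^+ n).
  elim: n => [|n IHn]; first exact: generated1.
  by rewrite expgS; apply: generatedM => //; apply: generated_in.
by case: k => n //=; apply: generatedV.
Qed.

Section IvanovCommutator.
Variables (w : 'F(2)) (hw : Ivanov_word w).

Definition keep_gen (k : 'I_2) (i : 'I_2) : 'F(2) :=
  if i == k then fgen k else 1.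

Lemma Ivanov_keep_gen k : feval (keep_gen k) w = 1.
Proof.
apply/(Ivanov_cyclic hw (is_free_free_group _)).
apply: (@generated_cyclic _ _ (fgen k)).
  by exists k; rewrite /keep_gen eqxx.
move=> _ [i ->]; rewrite /keep_gen; case: ifP => _.
  by exists (Posz 1).
by exists (Posz 0).
Qed.

(* By condition Ivanov_cyclic applied to the pairs (x_1, 1) and (1, x_2), w   *)
(* has exponent sum 0 in both letters; this makes eta_proj below well defined.*)
Lemma Ivanov_ab : ab_pi 'F(2) w = 1.
Proof.
pose p k : {hom 'F(2) -> abelianization 'F(2)} :=
  ab_pi 'F(2) \o feval (keep_gen k).
pose q u := p ord0 u * p ord_max u.
have qM : {morph q : u v / u * v}.
  move=> u v; rewrite /q !gmulfM -!mulgA; congr (_ * _).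
  by rewrite !mulgA; congr (_ * _); apply: abelianizationC.
have q1 : q 1 = 1 by rewrite /q !gmulf1 mulg1.
pose qm := isMultiplicative.Build _ _ q qM.
pose qu := Multiplicative_isUMagmaMorphism.Build _ _ q q1.
pose Q : {hom 'F(2) -> abelianization 'F(2)} := HB.pack q qm qu.
rewrite (@free_hom_ext _ _ (ab_pi 'F(2)) Q).
  by rewrite /Q /= /q /= !Ivanov_keep_gen !gmulf1 mulg1.
move=> i; rewrite /Q /= /q /= !feval_gen /keep_gen.
case: (unliftP ord0 i) => [j ->|->] /=.
  have -> : lift ord0 j = ord_max by apply: val_inj; case: j => -[].
  by rewrite gmulf1 mul1g.
by rewrite gmulf1 mulg1.
Qed.

End IvanovCommutator.

Section Double.
Variable w : 'F(2).

(* The infinite cyclic group C is the free group on one generator c.          *)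
Definition double_edge : {hom free_group unit -> 'F(2)} := feval (fun=> w).

(* Both A = F(a_1, a_2) and B = F(b_1, b_2) are copies of 'F(2).              *)
Definition Gdouble : groupType := amalgam double_edge double_edge.

Definition inA : {hom 'F(2) -> Gdouble} := am_inl double_edge double_edge.
Definition inB : {hom 'F(2) -> Gdouble} := am_inr double_edge double_edge.

Definition Dehn_twist (alpha : {hom Gdouble -> Gdouble}) : Prop :=
  bijective alpha /\
  (forall a, alpha (inA a) = inA a) /\
  exists k : int, forall b,
    alpha (inB b) = zexpg (inB w) k * inB b * (zexpg (inB w) k)^-1.

Definition retraction : {hom Gdouble -> 'F(2)} :=
  @am_lift _ _ _ double_edge double_edge _ idfun idfun (fun=> erefl).

Definition Z2_free_prod : groupType :=
  free_prod (abelianization 'F(2)) (abelianization 'F(2)).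

Definition eta_A : {hom 'F(2) -> Z2_free_prod} := fp_inl _ \o ab_pi 'F(2).
Definition eta_B : {hom 'F(2) -> Z2_free_prod} := @fp_inr _ _ \o ab_pi 'F(2).

Fact eta_glue : ab_pi 'F(2) w = 1 ->
  forall c, eta_A (double_edge c) = eta_B (double_edge c).
Proof.
move=> w1 c; pose p : {hom free_group unit -> abelianization 'F(2)} :=
  ab_pi 'F(2) \o double_edge.
have p1 : p =1 one_fun _.
  by apply: free_hom_ext => -[]; rewrite /p /= /double_edge feval_gen.
by have /= pc := p1 c; rewrite /eta_A /eta_B /= pc !gmulf1.
Qed.

Definition eta_proj (w1 : ab_pi 'F(2) w = 1) : {hom Gdouble -> Z2_free_prod} :=
  am_lift (eta_glue w1).

Lemma retraction_inA a : retraction (inA a) = a.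
Proof. exact: am_lift_inl. Qed.
Lemma retraction_inB b : retraction (inB b) = b.
Proof. exact: am_lift_inr. Qed.

Lemma eta_proj_inA (w1 : ab_pi 'F(2) w = 1) a :
  eta_proj w1 (inA a) = fp_inl _ (ab_pi 'F(2) a).
Proof. exact: am_lift_inl. Qed.
Lemma eta_proj_inB (w1 : ab_pi 'F(2) w = 1) b :
  eta_proj w1 (inB b) = fp_inr _ (ab_pi 'F(2) b).
Proof. exact: am_lift_inr. Qed.

End Double.

Definition factors_through (G K H : groupType) (f : G -> H) (p : G -> K) : Prop :=
  exists g : {hom K -> H}, f =1 g \o p.

(* Main.v *)
Require Import Defs.
From HB Require Import structures.
From mathcomp Require Import all_boot.
From mathcomp Require Import ssralg ssrint.

(* If phi(w) = 1, condition (ii) makes phi(A) and phi(B) cyclic, so phi kills *)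
(* [A, A] and [B, B] and factors through eta.  Otherwise, compose phi|A and   *)
(* phi|B with a map F -> F_2 that is injective on the finitely generated      *)
(* subgroup phi(G_w); condition (iii) then yields k such that phi|A is phi|B  *)
(* conjugated by phi(w)^k, and the Dehn twist of exponent k turns phi into a  *)
(* map that factors through the retraction.                                   *)

Set Implicit Arguments.
Unset Strict Implicit.
Unset Printing Implicit Defensive.

Local Open Scope group_scope.

(** The two restrictions [fA], [fB] of [phi] agree at [w], and the cases are whether this common
    value is trivial. If it is, condition (ii) makes both images commutative, and the induced maps
    on the two abelianizations assemble on the free product. If not, condition (iii) should compare
    [fA] with [fB], but it concerns endomorphisms of ['F(2)]; [free_fg_embed_F2] carries the
    finitely generated image of [phi] into ['F(2)] without loss. The conjugator then lies in the
    cyclic group of [Psi w], so it is the image of a power of [w], and conjugation by that power on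
    the B side is a Dehn twist ([Dehn_twist_zexpg]). After this twist both factors are mapped by
    [fA]. *)

(** * Cyclic subgroups and images of homomorphisms *)

Section Cyclic.
Variable G : groupType.

Lemma zexpg_hom (H : groupType) (f : {hom G -> H}) x k :
  f (zexpg x k) = zexpg (f x) k.
Proof. by case: k => n /=; rewrite ?gmulfV gmulfXn. Qed.

Lemma commute_zexpg (x y : G) k : commute x y -> commute x (zexpg y k).
Proof. by case: k => n xy /=; [|apply: commuteV]; apply: commuteX. Qed.

Lemma is_cyclic_commute (S : G -> Prop) x y :
  is_cyclic S -> S x -> S y -> commute x y.
Proof.
case=> z Sz /Sz[k ->] /Sz[l ->].
by apply/commute_zexpg/commute_sym/commute_zexpg.
Qed.

Lemma eq_is_cyclic (S T : G -> Prop) :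
  (forall x, S x <-> T x) -> is_cyclic S -> is_cyclic T.
Proof. by move=> ST [z Sz]; exists z => y; rewrite -ST. Qed.

End Cyclic.

Lemma homE_fgen (X : choiceType) (H : groupType)
    (f : {hom free_group X -> H}) u :
  f u = feval (f \o @fgen X) u.
Proof. exact: feval_unique. Qed.

(** Bridges condition (ii), phrased with the subgroup generated by a tuple, and condition (iii),
    phrased with the image of an endomorphism. *)
Lemma hom_range_feval (X : choiceType) (H : groupType) (f : X -> H) y :
  hom_range (feval f) y <-> generated (hom_range f) y.
Proof.
split=> [[u ->]|].
  rewrite /feval; elim: (fword u) => [|[x b] s IHs].
    by rewrite big_nil; apply: generated1.
  rewrite big_cons; apply: generatedM => //; rewrite /letter_eval /=.
  have fx : generated (hom_range f) (f x) by apply: generated_in; exists x.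
  by case: b => //; apply: generatedV.
elim=> {y} [_ [x ->]||_ _ _ [u ->] _ [v ->]|_ _ [u ->]].
- by exists (fgen x); rewrite feval_gen.
- by exists 1; rewrite gmulf1.
- by exists (u * v); rewrite gmulfM.
- by exists u^-1; rewrite gmulfV.
Qed.

Lemma generated_hom (G H : groupType) (f : {hom G -> H}) (S : G -> Prop)
    (T : H -> Prop) x :
  (forall y, S y -> T (f y)) -> generated S x -> generated T (f x).
Proof.
move=> ST; elim=> {x} [x /ST Tx||x y _ gx _ gy|x _ gx].
- exact: generated_in.
- by rewrite gmulf1; apply: generated1.
- by rewrite gmulfM; apply: generatedM.
- by rewrite gmulfV; apply: generatedV.
Qed.

(** * Free subgroups of infinite rank in the free group of rank 2 *)

Section Shift.

Definition shift (n : int) : {hom free_group int -> free_group int} :=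
  feval (fun k => fgen (k + n)%R).

Lemma shiftD m n u : shift m (shift n u) = shift (n + m)%R u.
Proof.
pose g : {hom free_group int -> free_group int} := shift m \o shift n.
rewrite -[LHS]/(g u); apply: free_hom_ext => k.
by rewrite /g /= !feval_gen GRing.addrA.
Qed.

Lemma shift0 u : shift 0%R u = u.
Proof.
pose g : {hom free_group int -> free_group int} := idfun.
rewrite -[RHS]/(g u); apply: free_hom_ext => k.
by rewrite /g /= feval_gen GRing.addr0.
Qed.

(* The semidirect product of F(Z), with generators y_n, by Z acting by shifts: *)
(* F_2 maps to it by x_1 |-> (1, 1) and x_2 |-> (y_0, 0), so that             *)
(* x_1^n x_2 x_1^-n |-> (y_n, 0); hence these conjugates freely generate.     *)
Definition shift_prod := (free_group int * int)%type.
HB.instance Definition _ := Choice.on shift_prod.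

Definition sp_one : shift_prod := (1, 0%R).
Definition sp_mul (p q : shift_prod) : shift_prod :=
  (p.1 * shift p.2 q.1, (p.2 + q.2)%R).
Definition sp_inv (p : shift_prod) : shift_prod :=
  (shift (- p.2)%R p.1^-1, (- p.2)%R).

Fact sp_mulA : associative sp_mul.
Proof.
move=> p q r; rewrite /sp_mul /= gmulfM shiftD mulgA GRing.addrA.
by rewrite [(q.2 + p.2)%R]GRing.addrC.
Qed.
Fact sp_mul1g : left_id sp_one sp_mul.
Proof. by case=> u n; rewrite /sp_mul shift0 mul1g GRing.add0r. Qed.
Fact sp_mulg1 : right_id sp_one sp_mul.
Proof. by case=> u n; rewrite /sp_mul gmulf1 mulg1 GRing.addr0. Qed.
Fact sp_mulVg : left_inverse sp_one sp_inv sp_mul.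
Proof. by case=> u n; rewrite /sp_mul -gmulfM mulVg gmulf1 GRing.addNr. Qed.
Fact sp_mulgV : right_inverse sp_one sp_inv sp_mul.
Proof.
by case=> u n; rewrite /sp_mul /= shiftD GRing.addNr shift0 mulgV GRing.addrN.
Qed.

HB.instance Definition _ := isGroup.Build shift_prod
  sp_mulA sp_mul1g sp_mulg1 sp_mulVg sp_mulgV.

Definition sp_inl (u : free_group int) : shift_prod := (u, 0%R).
Fact sp_inlM : {morph sp_inl : u v / u * v}.
Proof.
by move=> u v; rewrite /sp_inl /mul /= /sp_mul shift0 GRing.addr0.
Qed.
HB.instance Definition _ :=
  isMultiplicative.Build (free_group int) shift_prod sp_inl sp_inlM.
HB.instance Definition _ :=
  Multiplicative_isUMagmaMorphism.Build (free_group int) shift_prod sp_inl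
    erefl.

Definition conj_gen (k : nat) : 'F(2) :=
  fgen ord0 ^+ k * fgen ord_max * (fgen ord0 ^+ k)^-1.

Definition to_shift_prod : {hom 'F(2) -> shift_prod} :=
  feval (fun i : 'I_2 => if i == ord0 then (1, 1%R) : shift_prod
                         else sp_inl (fgen 0%R)).

Lemma to_shift_prod_conj_gen k : to_shift_prod (conj_gen k) =
  sp_inl (fgen (Posz k)).
Proof.
have E : to_shift_prod (fgen ord0 ^+ k) = (1, (Posz k)) :> shift_prod.
  rewrite gmulfXn /= feval_gen eqxx; elim: k => //= k IHk.
  rewrite expgS IHk /mul /= /sp_mul /= gmulf1 mulg1.
  by rewrite -PoszD add1n.
have F : to_shift_prod (fgen ord_max) = sp_inl (fgen 0%R) by exact: feval_gen.
(* In the semidirect product, conjugating by [(1, k)] shifts indices by [k], taking [y_0] to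
   [y_k]. *)
have -> : to_shift_prod (conj_gen k) =
    sp_mul (sp_mul (1, Posz k) (sp_inl (fgen 0%R))) (sp_inv (1, Posz k)).
  by rewrite -E -F /conj_gen !gmulfM gmulfV.
rewrite /sp_mul /sp_inv /sp_inl /= invg1 !gmulf1 mul1g mulg1 feval_gen.
by rewrite GRing.add0r GRing.addr0 GRing.addrN.
Qed.

End Shift.

(** The words of [s] involve finitely many letters, which are sent to distinct conjugates of [x_2]
    by powers of [x_1]. Since [to_shift_prod \o iota] is [nu] followed by an injection, it suffices
    that [nu] has a left inverse on the subgroup generated by [s]. *)
Lemma fg_embed_F2 (X : choiceType) (s : seq (free_group X)) :
  exists iota : {hom free_group X -> 'F(2)},
    forall u v, generated (fun x => x \in s) u ->
      generated (fun x => x \in s) v -> iota u = iota v -> u = v.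
Proof.
pose l := flatten [seq [seq t.1 | t <- fword u] | u <- s].
pose iota : {hom free_group X -> 'F(2)} :=
  feval (fun x => conj_gen (index x l)).
pose nu : {hom free_group X -> free_group int} :=
  feval (fun x => fgen (Posz (index x l))).
(* [mu] undoes [nu] on the letters of [l]; the default 1 only concerns indices that no letter of [l]
   receives. *)
pose mu : {hom free_group int -> free_group X} :=
  feval (fun k => if k is Posz j then nth 1 [seq fgen x | x <- l] j else 1).
have iotaE u : to_shift_prod (iota u) = sp_inl (nu u).
  pose g : {hom free_group X -> shift_prod} := to_shift_prod \o iota.
  pose h : {hom free_group X -> shift_prod} := sp_inl \o nu.
  rewrite -[LHS]/(g u) -[RHS]/(h u); apply: free_hom_ext => x.
  by rewrite /g /h /= !feval_gen to_shift_prod_conj_gen.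
have munuE x : x \in l -> mu (nu (fgen x)) = fgen x.
  move=> xl; rewrite /nu /mu /= !feval_gen.
  by rewrite (nth_map x) ?index_mem // nth_index.
pose E : {hom free_group X -> free_group X} := mu \o nu.
have Es u : u \in s -> E u = u.
  move=> us; rewrite (@feval_unique _ _ (E \o @fgen X) E) //.
  pose i : {hom free_group X -> free_group X} := idfun.
  rewrite -[RHS]/(i u) (@feval_unique _ _ (@fgen X) i) //.
  apply: eq_big_seq => t tu; rewrite /letter_eval /= munuE //.
  by apply/flatten_mapP; exists u => //; apply: map_f.
have Eg u : generated (fun x => x \in s) u -> E u = u.
  elim=> {u} [u /Es||u v _ Eu _ Ev|u _ Eu] //.
  - exact: gmulf1.
  - by rewrite gmulfM Eu Ev.
  - by rewrite gmulfV Eu.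
exists iota => u v gu gv /(congr1 to_shift_prod); rewrite !iotaE => -[nuv].
by rewrite -(Eg u gu) -(Eg v gv) /E /= nuv.
Qed.

Lemma free_fg_embed_F2 (F : groupType) (s : seq F) : is_free F ->
  exists iota : {hom F -> 'F(2)},
    forall x y, generated (fun x => x \in s) x ->
      generated (fun x => x \in s) y -> iota x = iota y -> x = y.
Proof.
case=> X [h [h' hK h'K]].
have h'M : {morph h' : x y / x * y}.
  by move=> x y; apply: (can_inj hK); rewrite gmulfM !h'K.
have h'1 : h' 1 = 1 by apply: (can_inj hK); rewrite gmulf1 h'K.
pose h'm := isMultiplicative.Build _ _ h' h'M.
pose h'u := Multiplicative_isUMagmaMorphism.Build _ _ h' h'1.
pose k : {hom F -> free_group X} := HB.pack h' h'm h'u.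
have [iota iotaI] := fg_embed_F2 [seq k x | x <- s].
have gk x : generated (fun x => x \in s) x ->
    generated (fun u => u \in [seq k x | x <- s]) (k x).
  by apply: generated_hom => y; apply: map_f.
exists (iota \o k) => x y /gk gx /gk gy /(iotaI _ _ gx gy).
exact: (can_inj h'K).
Qed.

Lemma quot_lift_abelianization (G H : groupType) (f : {hom G -> H}) :
  (forall x y, commute (f x) (f y)) ->
  exists g : {hom abelianization G -> H}, forall x, g (ab_pi G x) = f x.
Proof.
move=> cf; have fR x : is_commutator x -> f x = 1.
  by case=> y [z ->]; rewrite gmulfR; apply/eqP/commgP/cf.
exists (quot_lift fR) => x; exact: quot_lift_pi.
Qed.

(** * Construction of Dehn twists *)

Section DehnTwist.
Variables (w t : 'F(2)) (tw : commute t w).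

Definition twist_conj (t' b : 'F(2)) : Gdouble w := inB w (t' * b * t'^-1).

Fact twist_conjM t' : {morph twist_conj t' : x y / x * y}.
Proof. by move=> x y; rewrite /twist_conj -gmulfM !mulgA mulgVK. Qed.
Fact twist_conj1 t' : twist_conj t' 1 = 1.
Proof. by rewrite /twist_conj mulg1 divgg gmulf1. Qed.
HB.instance Definition _ t' :=
  isMultiplicative.Build 'F(2) (Gdouble w) (twist_conj t') (twist_conjM t').
HB.instance Definition _ t' :=
  Multiplicative_isUMagmaMorphism.Build 'F(2) (Gdouble w) (twist_conj t')
    (twist_conj1 t').

(** Conjugation by [t] fixes [w], so the identity on A and this conjugation on B still agree on the
    amalgamated subgroup. *)
Lemma twist_glue c :
  inA w (double_edge w c) = twist_conj t (double_edge w c).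
Proof.
pose f : {hom free_group unit -> Gdouble w} := inA w \o double_edge w.
pose g : {hom free_group unit -> Gdouble w} := twist_conj t \o double_edge w.
rewrite -[LHS]/(f c) -[RHS]/(g c); apply: free_hom_ext => x.
rewrite /f /g [LHS]am_glue /= /twist_conj /double_edge feval_gen.
by rewrite tw mulgK.
Qed.

Definition twist : {hom Gdouble w -> Gdouble w} := am_lift twist_glue.

Lemma twist_inA a : twist (inA w a) = inA w a.
Proof. exact: am_lift_inl. Qed.
Lemma twist_inB b : twist (inB w b) = inB w (t * b * t^-1).
Proof. exact: am_lift_inr. Qed.

End DehnTwist.

Lemma twistK (w t u : 'F(2)) (tw : commute t w) (uw : commute u w) :
  u * t = 1 -> cancel (twist tw) (twist uw).
Proof.
move=> ut1 x.
pose f : {hom Gdouble w -> Gdouble w} := twist uw \o twist tw.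
pose g : {hom Gdouble w -> Gdouble w} := idfun.
rewrite -[LHS]/(f x) -[RHS]/(g x); apply: am_hom_ext => y; rewrite /f /g /=.
  by rewrite -/(inA w y) !twist_inA.
rewrite -/(inB w y) !twist_inB; congr (inB w _).
have -> : u = t^-1 by apply: (mulIg t); rewrite ut1 mulVg.
by rewrite invgK !mulgA mulVg mul1g mulgVK.
Qed.

Lemma Dehn_twist_zexpg (w : 'F(2)) (k : int) (tw : commute (zexpg w k) w) :
  Dehn_twist (twist tw).
Proof.
split; last first.
  split=> [a|]; first exact: twist_inA.
  by exists k => b; rewrite twist_inB !gmulfM gmulfV !zexpg_hom.
have uw : commute (zexpg w k)^-1 w by apply/commute_sym/commuteV/commute_sym.
exists (twist uw); apply: twistK; [exact: mulVg|exact: mulgV].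
Qed.

(** * The two cases, [phi] trivial or non-trivial on [w] *)

Theorem theorem2p9 (w : 'F(2)) (hw : Ivanov_word w)
    (F : groupType) (F_free : is_free F) (F_nonab : nonabelian F)
    (phi : {hom Gdouble w -> F}) :
  exists alpha : {hom Gdouble w -> Gdouble w},
    Dehn_twist alpha /\
    (factors_through (phi \o alpha) (retraction w) \/
     factors_through (phi \o alpha) (eta_proj (Ivanov_ab hw))).
Proof.
pose fA : {hom 'F(2) -> F} := phi \o inA w.
pose fB : {hom 'F(2) -> F} := phi \o inB w.
have fABw : fA w = fB w.
  have /= := am_glue (double_edge w) (double_edge w) (fgen tt).
  by rewrite /fA /fB /double_edge /= feval_gen => ->.
have [fw1|fw1] := eqVneq (fA w) 1.
  have comm (f : {hom 'F(2) -> F}) : f w = 1 -> forall x y, commute (f x) (f y).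
    rewrite homE_fgen => /(Ivanov_cyclic hw F_free) cyc x y.
    apply: (is_cyclic_commute cyc); rewrite homE_fgen; apply/hom_range_feval.
      by exists x.
    by exists y.
  have [gA gAE] := quot_lift_abelianization (comm fA fw1).
  have [gB gBE] := quot_lift_abelianization (comm fB (etrans (esym fABw) fw1)).
  have tw : commute (zexpg w 0) w by apply/commute_sym/commuteX.
  exists (twist tw); split; first exact: Dehn_twist_zexpg.
  right; exists (fp_lift gA gB).
  pose g : {hom Gdouble w -> F} := fp_lift gA gB \o eta_proj (Ivanov_ab hw).
  pose f : {hom Gdouble w -> F} := phi \o twist tw.
  apply: (@am_hom_ext _ _ _ _ _ _ f g) => x; rewrite /f /g /=.
    by rewrite -/(inA w x) twist_inA eta_proj_inA fp_lift_inl gAE.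
  rewrite -/(inB w x) twist_inB invg1 mulg1 mul1g.
  by rewrite eta_proj_inB fp_lift_inr gBE.
(* The images of the four generators of [Gdouble w], which generate the image of [phi]. *)
pose s := [seq fA (fgen i) | i <- enum 'I_2] ++
          [seq fB (fgen i) | i <- enum 'I_2].
have gen (f : {hom 'F(2) -> F}) : (forall i, f (fgen i) \in s) ->
    forall x, generated (fun y => y \in s) (f x).
  move=> fs x; have : hom_range (feval (f \o @fgen _)) (f x).
    by exists x; rewrite -homE_fgen.
  move/hom_range_feval; apply: (generated_hom (f := idfun)) => _ [i ->].
  exact: fs.
have genA x : generated (fun y => y \in s) (fA x).
  apply: gen => i; rewrite mem_cat; apply/orP; left.
  by apply: (map_f (fun i => fA (fgen i))); rewrite mem_enum.
have genB x : generated (fun y => y \in s) (fB x).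
  apply: gen => i; rewrite mem_cat; apply/orP; right.
  by apply: (map_f (fun i => fB (fgen i))); rewrite mem_enum.
have [iota iotaI] := free_fg_embed_F2 s F_free.
pose Phi : {hom 'F(2) -> 'F(2)} := iota \o fA.
pose Psi : {hom 'F(2) -> 'F(2)} := iota \o fB.
(* A cyclic image would give [Psi w = 1] by condition (ii), hence [fA w = 1] by injectivity of
   [iota] on the image of [phi]. *)
have PsiN : ~ is_cyclic (hom_range Psi).
  move=> cyc; case/eqP: fw1; apply: (iotaI (fA w) 1); rewrite ?gmulf1 //.
    exact: generated1.
  rewrite fABw -[LHS]/(Psi w) homE_fgen.
  apply/(Ivanov_cyclic hw (is_free_free_group _)).
  apply: eq_is_cyclic cyc => y; rewrite -hom_range_feval.
  by split=> -[x ->]; exists x; [|apply/esym]; apply: homE_fgen.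
have PhiPsi : Phi w = Psi w by exact: (congr1 iota fABw).
have [_ [[n ->] E]] := Ivanov_endo hw PsiN PhiPsi.
have tw : commute (zexpg w n) w by apply/commute_sym/commute_zexpg.
exists (twist tw); split; first exact: Dehn_twist_zexpg.
left; exists fA.
pose g : {hom Gdouble w -> F} := fA \o retraction w.
pose f : {hom Gdouble w -> F} := phi \o twist tw.
apply: (@am_hom_ext _ _ _ _ _ _ f g) => x; rewrite /f /g /=.
  by rewrite -/(inA w x) twist_inA retraction_inA.
rewrite -/(inB w x) twist_inB retraction_inB.
(* After applying [iota], the equality to prove is the conjugation formula [E], with conjugator
   [Psi (zexpg w n)]. *)
apply: (iotaI (fB _) (fA _)) => //.
by rewrite -[RHS]/(Phi x) E -zexpg_hom -gmulfV -!gmulfM.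
Qed.
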